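(* Assume the RRK (relaxation Runge-Kutta) method takes $K$ steps, the last step being taken as an IDT step with step size $\Delta t^*=T-t_{K-1}$; let $\overline y$ be the vector of all computed step values and internal stages and $\widetilde E$ the associated reduced state-equation operator (see context). For any $\overline{w}=(w_0,W_1,w_1,\dots,W_K,w_K)\in\mathbb R^{\overline N}$, the adjoint RRK system $\widetilde E'(\overline y)^\top\,\overline\lambda=\overline w$ for $\overline\lambda=(\lambda_0,\Lambda_1,\lambda_1,\dots,\Lambda_K,\lambda_K)$ is given by the following time-stepping formulas (back substitution). First, $\lambda_K=w_K$ and the first adjoint step is $$\lambda_{K-1}=\lambda_K+\sum_{i=1}^s\Lambda_{K,i}+\xi_K\nabla_y\gamma_K+w_{K-1},\qquad \xi_K=\Delta t^*\sum_{i=1}^s b_iF_{K,i}^\top\lambda_K,$$ $$\Lambda_{K,i}=\Delta t^*J_{K,i}^\top\Big(\gamma_Kb_i\lambda_K+\sum_{j=1}^s a_{ji}\Lambda_{K,j}\Big)+\xi_K\nabla_Y\gamma_{K,i}+W_{K,i},\qquad i=1,\dots,s.$$ Then, for $k=K-1,\dots,1$, $$\lambda_{k-1}=\lambda_k+\sum_{i=1}^s\Lambda_{k,i}+(\xi_k-\xi_* )\nabla_y\gamma_k+w_{k-1},$$ where $$\Lambda_{k,i}=\Delta t\,J_{k,i}^\top\Big(\gamma_kb_i\lambda_k+\sum_{j=1}^s a_{ji}\Lambda_{k,j}\Big)+(\xi_k-\xi_* )\nabla_Y\gamma_{k,i}+W_{k,i},\qquad i=1,\dots,s,$$ $$\xi_k=\Delta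 t\sum_{i=1}^s b_iF_{k,i}^\top\lambda_k,\qquad \xi_*=\Delta t\sum_{i=1}^s\sum_{j=1}^s a_{ji}F_{K,i}^\top\Lambda_{K,j}.$$
   Context: Consider the initial value problem $y'(t)=f(y(t),t)$, $t_0=0<t\le T$, $y(0)=y_{\rm init}\in\mathbb R^N$, with $f$ differentiable in $y$ and a smooth convex entropy function $\eta:\mathbb R^N\to\mathbb R$. Fix an $s$-stage Runge-Kutta method with coefficients $a_{ij},b_i,c_i$ ($1\le i,j\le s$) and step size $\Delta t>0$. Vectors of length $\overline N=N+N(s+1)K$ are written in blocks as $\overline y=(y_0,Y_1,y_1,\dots,Y_K,y_K)$ with $y_k\in\mathbb R^N$, $Y_k=(Y_{k,1},\dots,Y_{k,s})\in\mathbb R^{sN}$; the same convention is used for $\overline w=(w_0,W_1,w_1,\dots)$ and $\overline\lambda=(\lambda_0,\Lambda_1,\lambda_1,\dots)$. RRK method with $K$ steps ($K$ fixed): let $h_k=\Delta t$ for $k=1,\dots,K-1$ and $h_K=\Delta t^*$. Set $y_0=y_{\rm init}$ and, for $k=1,\dots,K$, $$Y_{k,i}=y_{k-1}+h_k\sum_ja_{ij}F_{k,j},\qquad y_k=y_{k-1}+\gamma_kh_k\sum_ib_iF_{k,i},$$ where $F_{k,i}=f(Y_{k,i},t_{k-1}+c_ih_k)$, $J_{k,i}=\frac{\partial f}{\partial y}(Y_{k,i},t_{k-1}+c_ih_k)$, $t_k=t_{k-1}+\gamma_k\Delta t$ for $k\le K-1$, $t_K=T$, and $$\Delta t^*=T-t_{K-1}=T-t_0-\Delta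 t\sum_{\ell=1}^{K-1}\gamma_\ell>0.$$ The relaxation parameter $\gamma_k$ is the non-zero root closest to $1$ of $$r_k(\gamma)=\eta\Big(y_{k-1}+\gamma h_k\sum_{i}b_iF_{k,i}\Big)-\eta(y_{k-1})-\gamma h_k\sum_{i}b_i\nabla\eta(Y_{k,i})^\top F_{k,i};$$ it is assumed that this root exists and $\partial r_k/\partial\gamma\neq0$ there. For $k\le K-1$ this implicitly defines $\gamma_k$ as a differentiable function of $(y_{k-1},Y_k)$; $\Delta t^*$ is then a function of $(y_{\ell-1},Y_\ell)$, $\ell=1,\dots,K-1$, through $\gamma_1,\dots,\gamma_{K-1}$; and $\gamma_K$ is a function of $(y_{K-1},Y_K)$ and of $\Delta t^*$, hence of all $(y_{\ell-1},Y_\ell)$, $\ell=1,\dots,K$. All blocks of $\overline y$ are regarded as independent variables in these dependencies. In differentiation, $F_{k,i}$ is viewed as a function of $Y_{k,i}$ only (the times $t_{k-1}+c_ih_k$ at which $f$ is evaluated are held fixed). For all $k=1,\dots,K$, $$(\nabla_y\gamma_k)^\top=-\Big(\frac{\partial r_k}{\partial\gamma}\Big)^{-1}\frac{\partial r_k}{\partial y_{k-1}},\qquad(\nabla_Y\gamma_{k,i})^\top=-\Big(\frac{\partial r_k}{\partial\gamma}\Big)^{-1}\frac{\partial r_k}{\partial Y_{k,i}},$$ evaluated at $\gamma=\gamma_k$ (partial derivatives of $\gamma_k$ with respect to $y_{k-1}$ and $Y_{k,i}$; for $k=K$ with step size $h_K=\Delta t^*$ in $r_K$). The reduced state-equation operator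 $\widetilde E$ (defined near $\overline y$ in $\mathbb R^{\overline N}$) has blocks, in the same ordering: initial block $y_0-y_{\rm init}$; and for each $k=1,\dots,K$ the stage blocks $Y_{k,i}-y_{k-1}-h_k\sum_ja_{ij}F_{k,j}$ ($i=1,\dots,s$) followed by the step block $y_k-y_{k-1}-\gamma_kh_k\sum_ib_iF_{k,i}$, with $\gamma_k=\gamma_k(\overline y)$ and $h_K=\Delta t^*(\overline y)$. $\widetilde E'(\overline y)$ denotes its total Jacobian matrix, including the dependence of all $\gamma_k$ and of $\Delta t^*$ on $\overline y$. *)

(* Defs.v *)
From HB Require Import structures.
From mathcomp Require Import all_boot all_order all_algebra.
From mathcomp Require Import boolp classical_sets functions reals topology.
From mathcomp Require Import normedtype derive convex.
Set Implicit Arguments.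
Unset Strict Implicit.
Unset Printing Implicit Defensive.
Import Order.TTheory GRing.Theory Num.Theory.
Import numFieldNormedType.Exports.
Local Open Scope classical_set_scope.
Local Open Scope ring_scope.

Section calculus.
Context {R : realType}.

Definition dot n (u v : 'cV[R]_n) : R := (u^T *m v) 0 0.

Definition grad n (g : 'cV[R]_n -> R) (x : 'cV[R]_n) : 'cV[R]_n :=
  \col_j 'D_(delta_mx j 0) g x.

(* Usual convention for columns, [jac f x i j] being the derivative of f_i in
   direction e_j; the library's ['J f x], for row vectors, is the transpose. *)
Definition jac m n (f : 'cV[R]_n -> 'cV[R]_m) (x : 'cV[R]_n) : 'M[R]_(m, n) :=
  \matrix_(i, j) ('D_(delta_mx j 0) f x) i 0.

Fixpoint Ck n (m : nat) (g : 'cV[R]_n -> R) : Prop :=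
  if m is m'.+1 then
    (forall x, differentiable g x) /\
    (forall j, Ck m' (fun x => 'D_(delta_mx j 0) g x))
  else continuous g.

Definition smooth n (g : 'cV[R]_n -> R) : Prop := forall m, Ck m g.

Definition set_col m n (Y : 'M[R]_(m, n)) (i : 'I_n) (x : 'cV[R]_m) :
    'M[R]_(m, n) :=
  \matrix_(j, l) if l == i then x j 0 else Y j l.

End calculus.

(* Vectors (y_0, Y_1, y_1, ..., Y_K, y_K): there are K(s+1)+1 blocks of length
   N, laid out by [mxvec_index] (row-major, rows = blocks).  With
   p = q(s+1) + r and r <= s, block number p is y_q if r = 0 and the stage
   Y_{q+1,r} otherwise.  Steps k are numbered 1, ..., K as usual, whereas
   stages are indexed by ['I_s], from 0. *)
Section blocks.
Context {R : realType} {N s K : nat}.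

Definition total_dim : nat := (K * s.+1).+1 * N.

Definition step_pos (k : nat) : 'I_(K * s.+1).+1 := inord (k * s.+1).
Definition stage_pos (k : nat) (i : 'I_s) : 'I_(K * s.+1).+1 :=
  inord (k.-1 * s.+1 + i.+1).

Definition block (v : 'cV[R]_total_dim) (p : 'I_(K * s.+1).+1) : 'cV[R]_N :=
  \col_j v (mxvec_index p j) 0.

Definition step_of (v : 'cV[R]_total_dim) (k : nat) : 'cV[R]_N :=
  block v (step_pos k).
Definition stage_of (v : 'cV[R]_total_dim) (k : nat) (i : 'I_s) : 'cV[R]_N :=
  block v (stage_pos k i).
Definition stages_of (v : 'cV[R]_total_dim) (k : nat) : 'M[R]_(N, s) :=
  \matrix_(j, i) stage_of v k i j 0.

Definition assemble (y : nat -> 'cV[R]_N) (Y : nat -> 'I_s -> 'cV[R]_N) :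
    'cV[R]_total_dim :=
  (mxvec (\matrix_(p < (K * s.+1).+1, j < N)
    (match (p %% s.+1)%N with
     | 0%N => y (p %/ s.+1)%N
     | i.+1 => oapp (Y (p %/ s.+1).+1) 0 (insub i)
     end) j 0))^T.

Lemma block_assemble y Y p j :
  block (assemble y Y) p j 0 =
  (match (p %% s.+1)%N with
   | 0%N => y (p %/ s.+1)%N
   | i.+1 => oapp (Y (p %/ s.+1).+1) 0 (insub i)
   end) j 0.
Proof. by rewrite !mxE mxvecE mxE. Qed.

Lemma step_of_assemble y Y k : (k <= K)%N -> step_of (assemble y Y) k = y k.
Proof.
move=> kK; apply/colP => j; rewrite block_assemble inordK; last first.
  by rewrite ltnS leq_mul2r kK orbT.
by rewrite modnMl mulnK.
Qed.

Lemma stage_of_assemble y Y k i :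
  (0 < k <= K)%N -> stage_of (assemble y Y) k i = Y k i.
Proof.
case: k => // k kK; apply/colP => j; rewrite block_assemble inordK /=.
  rewrite modnMDl modn_small ?ltnS// divnMDl// divn_small ?ltnS// addn0.
  by rewrite valK.
rewrite ltnS (leq_trans _ (leq_mul kK (leqnn _)))// mulSn addnC.
by rewrite leq_add2r (leq_trans (ltn_ord i)).
Qed.

End blocks.
Arguments total_dim : clear implicits.

Record rrk_setup (R : realType) (N s : nat) := RRKSetup {
  rk_a : 'M[R]_s;
  rk_b : 'I_s -> R;
  rk_c : 'I_s -> R;
  rhs : 'cV[R]_N -> R -> 'cV[R]_N;
  entropy : 'cV[R]_N -> R;
  tend : R;
  dt : R;
  yinit : 'cV[R]_N }.

(* The relaxation parameters as implicit functions: [gam k] (used for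
   0 < k < K) depends on (y_{k-1}, Y_k), while [gam_last] depends on
   (y_{K-1}, Y_K) and on the length of the last step. *)
Record relax_funs (R : realType) (N s : nat) := RelaxFuns {
  gam : nat -> 'cV[R]_N -> 'M[R]_(N, s) -> R;
  gam_last : 'cV[R]_N -> 'M[R]_(N, s) -> R -> R }.

Section rrk.
Context {R : realType} {N s : nat}.
Variables (P : rrk_setup R N s) (G : relax_funs R N s) (K : nat).
Local Notation vec := 'cV[R]_(total_dim N s K).
Local Notation a := (rk_a P).
Local Notation b := (rk_b P).
Local Notation eta := (entropy P).

(* t_k = t_0 + dt * (gamma_1 + ... + gamma_k) with t_0 = 0, for k <= K-1. *)
Definition step_time (v : vec) (k : nat) : R :=
  dt P * \sum_(1 <= l < k.+1) gam G l (step_of v l.-1) (stages_of v l).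

Definition dt_star (v : vec) : R := tend P - step_time v K.-1.

Definition step_size (v : vec) (k : nat) : R :=
  if (k < K)%N then dt P else dt_star v.

(* gamma_k as a function of (y_{k-1}, Y_k), with the length of the last step
   frozen at its value at [v] when k = K. *)
Definition gam_frozen (v : vec) (k : nat) (y : 'cV[R]_N) (Y : 'M[R]_(N, s)) : R :=
  if (k < K)%N then gam G k y Y else gam_last G y Y (dt_star v).

Definition gam_at (v : vec) (k : nat) : R :=
  gam_frozen v k (step_of v k.-1) (stages_of v k).

(* F_{k,i} as a function of the stage only: the time at which the right-hand
   side is evaluated is that of the computed solution [base], so it is not
   differentiated. *)
Definition stage_rhs (base : vec) (k : nat) (i : 'I_s) (x : 'cV[R]_N) : 'cV[R]_N :=
  rhs P x (step_time base k.-1 + rk_c P i * step_size base k).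

Definition F_at (base : vec) (k : nat) (i : 'I_s) : 'cV[R]_N :=
  stage_rhs base k i (stage_of base k i).
Definition J_at (base : vec) (k : nat) (i : 'I_s) : 'M[R]_N :=
  jac (stage_rhs base k i) (stage_of base k i).

Definition relax_res (base : vec) (k : nat) (h : R) (y : 'cV[R]_N)
    (Y : 'M[R]_(N, s)) (g : R) : R :=
  let F i := stage_rhs base k i (col i Y) in
  eta (y + (g * h) *: \sum_i b i *: F i) - eta y
  - g * h * \sum_i b i * dot (grad eta (col i Y)) (F i).

(* r_k as a function of gamma at the computed solution. *)
Definition relax_res_at (base : vec) (k : nat) : R -> R :=
  relax_res base k (step_size base k) (step_of base k.-1) (stages_of base k).

(* [base] consists of the step values and stages computed by the method, with
   relaxation parameters [gam_at base k]. *)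
Definition rrk_solution (base : vec) : Prop :=
  step_of base 0 = yinit P /\
  forall k, (0 < k <= K)%N ->
  [/\ forall i, stage_of base k i = step_of base k.-1
        + step_size base k *: \sum_j a i j *: F_at base k j,
      step_of base k = step_of base k.-1
        + (gam_at base k * step_size base k) *: \sum_i b i *: F_at base k i,
      gam_at base k != 0 /\ relax_res_at base k (gam_at base k) = 0
    & forall g, g != 0 -> relax_res_at base k g = 0 ->
        `|gam_at base k - 1| <= `|g - 1| ].

(* The functions in [G] are the branches of roots through the computed
   relaxation parameters that r_k = 0 implicitly defines near [base]. *)
Definition implicit_branches (base : vec) : Prop :=
  (forall k, (0 < k < K)%N ->
    let p0 := (step_of base k.-1, stages_of base k) in
    {for p0, continuous (fun p => gam G k p.1 p.2)} /\
    \forall p \near p0,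
      relax_res base k (dt P) p.1 p.2 (gam G k p.1 p.2) = 0) /\
  (let p0 := (step_of base K.-1, stages_of base K, dt_star base) in
    {for p0, continuous (fun p => gam_last G p.1.1 p.1.2 p.2)} /\
    \forall p \near p0,
      relax_res base K p.2 p.1.1 p.1.2 (gam_last G p.1.1 p.1.2 p.2) = 0).

Definition grad_y_gam (base : vec) (k : nat) : 'cV[R]_N :=
  grad (fun y => gam_frozen base k y (stages_of base k)) (step_of base k.-1).
Definition grad_Y_gam (base : vec) (k : nat) (i : 'I_s) : 'cV[R]_N :=
  grad (fun x => gam_frozen base k (step_of base k.-1)
                   (set_col (stages_of base k) i x)) (stage_of base k i).

Definition grad_y_res (base : vec) (k : nat) : 'cV[R]_N :=
  grad (fun y => relax_res base k (step_size base k) y (stages_of base k)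
                   (gam_at base k)) (step_of base k.-1).
Definition grad_Y_res (base : vec) (k : nat) (i : 'I_s) : 'cV[R]_N :=
  grad (fun x => relax_res base k (step_size base k) (step_of base k.-1)
                   (set_col (stages_of base k) i x) (gam_at base k))
       (stage_of base k i).

(* Reduced state-equation operator, as a function of [v]; [base] only enters
   through the times at which the right-hand side is evaluated. *)
Definition reduced_op (base v : vec) : vec :=
  assemble
    (fun k => if k == 0%N then step_of v 0 - yinit P else
       step_of v k - step_of v k.-1
       - (gam_at v k * step_size v k) *:
           \sum_i b i *: stage_rhs base k i (stage_of v k i))
    (fun k i => stage_of v k i - step_of v k.-1
       - step_size v k *: \sum_j a i j *: stage_rhs base k j (stage_of v k j)).

Definition xi (base lam : vec) (k : nat) : R :=
  step_size base k * \sum_i b i * dot (F_at base k i) (step_of lam k).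

Definition xi_star (base lam : vec) : R :=
  dt P * \sum_i \sum_j a j i * dot (F_at base K i) (stage_of lam K j).

End rrk.

(* Main.v *)
From HB Require Import structures.
Require Import Defs.
From mathcomp Require Import all_boot all_order all_algebra.
From mathcomp Require Import boolp classical_sets functions reals topology.
From mathcomp Require Import normedtype derive convex.
From mathcomp Require Import interval_inference landau ring lra.
Import Order.TTheory GRing.Theory Num.Theory.
Import numFieldNormedType.Exports.
Local Open Scope classical_set_scope.
Local Open Scope ring_scope.
Set Implicit Arguments.
Unset Strict Implicit.
Unset Printing Implicit Defensive.

(** Everything reduces to one computation of the differential of the reduced
    operator at the computed solution, followed by a summation by parts over
    the time steps.

    The residual r_k depends on gamma and on the step size h only through the
    product m = gamma h; it is a function of (y, Y, m), called [product_res]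
    below.  This function is differentiable, and the relaxation parameter is a
    continuous branch of roots of (p, g) |-> product_res (p, g h).  A continuous
    branch of roots of a function that is differentiable at one point, with
    nonzero partial derivative there, is differentiable at that point
    ([implicit_is_diff]).  One application of this fact with an arbitrary parameter space
    ([branch_is_diff]) yields at the same time the formulas for the partial
    gradients of gamma_k and the differentiability of gamma_k as a function of
    the whole vector.  For k < K the step size is constant; hence gamma_k, then
    the length of the last step, and finally gamma_K are differentiable.

    Because only the product enters the residual, the differential of gamma_K
    with respect to the step size is - gamma_K / h_K, so that it cancels against
    the explicit factor h_K in the increment gamma_K h_K
    ([is_diff_increment]).  The step block of step K therefore has the same
    linearization as that of any other step, and the variation of the length of
    the last step, which is - dt times the sum of the variations of the
    gamma_l for l < K, survives only in the stage blocks of step K.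

    Pairing the differential with lambda gives, for each step, the terms of the
    adjoint recursion minus a defect: xi_star times the variation of gamma_k
    if k < K, and minus the sum of these quantities if k = K
    ([dot_dreduced_pair]).  The defects cancel in the sum over k, which
    identifies the transposed Jacobian applied to lambda blockwise
    ([jac_reduced_op_tr]); solving each block equation for its leading term
    gives the recursion. *)

(** * Differentials of maps between normed spaces *)

Section differentials.
Context {R : realType}.
Implicit Types U V W : normedModType R.

Lemma cvg_pair_point (T : Type) (U V : topologicalType) (F : set_system T)
    (FF : Filter F) (f : T -> U) (g : T -> V) (a : U) (b : V) :
  f @ F --> a -> g @ F --> b -> (fun t => (f t, g t)) @ F --> (a, b).
Proof. by move=> fa gb; exact: (cvg_pair fa gb). Qed.

Lemma is_diff_ext V W (f g df dg : V -> W) x :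
  is_diff x f df -> f =1 g -> df =1 dg -> is_diff x g dg.
Proof. by move=> fP /funext <- /funext <-. Qed.

Lemma is_diff_sum V W (I : Type) (r : seq I) (Q : pred I) (f df : I -> V -> W) x :
  (forall i, Q i -> is_diff x (f i) (df i)) ->
  is_diff x (fun v => \sum_(i <- r | Q i) f i v)
    (fun h => \sum_(i <- r | Q i) df i h).
Proof.
move=> fP; elim: r => [|i r IH].
  by apply: (is_diff_ext (is_diff_cst 0 x)) => v; rewrite big_nil.
case Qi : (Q i); last by apply: (is_diff_ext IH) => v; rewrite big_cons Qi.
by apply: (is_diff_ext (is_diffD (fP i Qi) IH)) => v; rewrite big_cons Qi.
Qed.

Lemma is_diff_scale_cst V W (k dk : V -> R) (w : W) x :
  is_diff x k dk -> is_diff x (fun v => k v *: w) (fun h => dk h *: w).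
Proof.
move=> kP; apply: DiffDef; first exact: differentiableZl.
by rewrite diffZl// diff_val.
Qed.

Lemma is_diff_mx V m n (f : V -> 'M[R]_(m, n)) (df : V -> 'M[R]_(m, n)) x :
  (forall i j, is_diff x (fun v => f v i j) (fun h => df h i j)) ->
  is_diff x f df.
Proof.
move=> fP.
rewrite (_ : f = fun v => \sum_i \sum_j f v i j *: delta_mx i j); last first.
  by apply/funext => v; rewrite -matrix_sum_delta.
apply: is_diff_eq.
  apply: is_diff_sum => i _; apply: is_diff_sum => j _.
  exact: is_diff_scale_cst (fP i j).
by apply/funext => h; rewrite -matrix_sum_delta.
Qed.

Lemma is_diff_coord m n (x : 'M[R]_(m, n)) i j :
  is_diff x (fun v : 'M[R]_(m, n) => v i j : R) (fun h => h i j).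
Proof.
have lin : linear (fun v : 'M[R]_(m, n) => v i j : R).
  by move=> a u v; rewrite !mxE.
pose linM := GRing.isLinear.Build _ _ _ _ _ lin.
pose L : {linear 'M[R]_(m, n) -> R} := HB.pack (fun v : 'M[R]_(m, n) => v i j) linM.
apply: DiffDef; first exact: differentiable_coord.
by rewrite (@diff_lin _ _ _ L)//; exact: coord_continuous.
Qed.

(** Matrix spaces are finite-dimensional, so linearity alone gives continuity. *)
Lemma is_diff_linear m n W (L : 'M[R]_(m, n) -> W) x :
  linear L -> is_diff x L L.
Proof.
move=> lin; pose linM := GRing.isLinear.Build _ _ _ _ _ lin.
pose L' : {linear 'M[R]_(m, n) -> W} := HB.pack L linM.
have LE : L = fun v => \sum_i \sum_j v i j *: L (delta_mx i j).
  apply/funext => v; rewrite {1}(matrix_sum_delta v) -[LHS]/(L' _) linear_sum.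
  apply: eq_bigr => i _; rewrite linear_sum; apply: eq_bigr => j _.
  by rewrite linearZ.
rewrite LE; apply: is_diff_sum => i _; apply: is_diff_sum => j _.
exact: is_diff_scale_cst (is_diff_coord _ _ _).
Qed.

Lemma is_diff_scale V m n (k dk : V -> R) (f df : V -> 'M[R]_(m, n)) x :
  is_diff x k dk -> is_diff x f df ->
  is_diff x (fun v => k v *: f v) (fun h => dk h *: f x + k x *: df h).
Proof.
move=> kP fP; apply: is_diff_mx => i j.
have fijP : is_diff x (fun v => f v i j) (fun h => df h i j).
  exact: (is_diff_comp _ (is_diff_coord (f x) i j)).
rewrite (_ : (fun v => _) = k * (fun v => f v i j)); last first.
  by apply/funext => v; rewrite !mxE.
apply: is_diff_eq; apply/funext => h.
rewrite !mxE/= [RHS]addrC; congr (_ + _).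
by rewrite mulrC.
Qed.

Lemma is_diff_fst U V (x : U * V) : is_diff x fst fst.
Proof.
pose L : {linear (U * V)%type -> U} := fst.
have c : continuous L by move=> y; exact: cvg_fst.
by apply: DiffDef; [exact: (linear_differentiable x c)|exact: (diff_lin x c)].
Qed.

Lemma is_diff_snd U V (x : U * V) : is_diff x snd snd.
Proof.
pose L : {linear (U * V)%type -> V} := snd.
have c : continuous L by move=> y; exact: cvg_snd.
by apply: DiffDef; [exact: (linear_differentiable x c)|exact: (diff_lin x c)].
Qed.

Lemma is_diff_pairf U V W (f df : U -> V) (g dg : U -> W) x :
  is_diff x f df -> is_diff x g dg ->
  is_diff x (fun u => (f u, g u)) (fun u => (df u, dg u)).
Proof. by move=> fP gP; apply: is_diff_eq. Qed.

End differentials.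

(** * Differentiating an implicitly defined function *)

Section implicit.
Context {R : realType}.

(** Let D be the differential of [Phi] at (x, g x) and c = D (0, 1).  Since
    Phi (u, g u) vanishes, c (g (x + h) - g x) + D (h, 0) is at most a
    small multiple of |h| + |g (x + h) - g x|.  By continuity of [g] this applies
    for all small h; it shows first that the increment of [g] is O(h) and then
    that the error is o(h). *)
Lemma implicit_is_diff (U : normedModType R) (Phi : U * R -> R) (g : U -> R) x :
  differentiable Phi (x, g x) -> {for x, continuous g} ->
  (\forall u \near x, Phi (u, g u) = 0) ->
  'd Phi (x, g x) (0, 1) != 0 ->
  is_diff x g (fun h => - ('d Phi (x, g x) (0, 1))^-1 * 'd Phi (x, g x) (h, 0)).
Proof.
move=> PhiD gC Phi0; set D := 'd Phi (x, g x); set c := D (0, 1) => c0.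
set L := fun h => _.
have Llin : linear L.
  move=> a u v; rewrite /L.
  have -> : (a *: u + v, 0) = a *: (u, 0) + (v, 0) :> U * R.
    by congr (_, _); rewrite /= scaler0 addr0.
  by rewrite linearP/= mulrDr scalerAr.
pose linM := GRing.isLinear.Build _ _ _ _ _ Llin.
pose L' : {linear U -> R} := HB.pack L linM.
have Dc : continuous D by exact: diff_continuous.
have Lc : continuous L'.
  move=> u; apply: (@cvg_comp _ _ _ (fun h => D (h, 0)) ( *%R (- c^-1)) _
    (nbhs (D (u, 0)))); last exact: mulrl_continuous.
  have pc : (fun h : U => (h, 0) : U * R) @ u --> ((u, 0) : U * R).
    by apply: cvg_pair_point => //; exact: cvg_cst.
  by apply: cvg_comp; [exact: pc | exact: Dc].
suff gD : g \o shift x = cst (g x) + L' +o_ 0 id.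
  have gd : 'd g x = L' :> (U -> R) by exact: diff_unique.
  by apply: DiffDef => //; apply/diff_locallyP; rewrite gd.
apply/eqaddoP => _/posnumP[e].
have [M M0 LM] := linear_lipschitz Lc.
(* The bound 1/2 absorbs the increment of [g] and gives |h| + |d h| <=
   (2M + 2) |h|; the second bound then makes the error at most e |h|. *)
pose e1 := Num.min 2^-1 (e%:num / (2 * M + 2)).
have M2 : 0 < 2 * M + 2 by rewrite ltr_wpDl// mulr_ge0// ltW.
have e10 : 0 < e1 by rewrite lt_min invr_gt0 ltr0n divr_gt0.
have ce : 0 < `|c| * e1 by rewrite mulr_gt0 ?normr_gt0.
have := diff_locally PhiD => /eqaddoP/(_ _ ce) PhiO.
pose d h := g (h + x) - g x.
have d0 : (fun h : U => (h, d h) : U * R) @ 0 --> (0 : U * R).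
  apply: cvg_pair_point => //.
  have sc : (fun h : U => h + x) @ 0 --> x.
    have := @cvgD _ _ _ (nbhs (0 : U)) _ id (cst x) 0 x cvg_id (cvg_cst _).
    by rewrite add0r; exact.
  have gs : (fun h : U => g (h + x)) @ 0 --> g x.
    by apply: cvg_comp; [exact: sc | exact: gC].
  have := @cvgB _ _ _ _ _ _ (cst (g x)) _ (g x) gs (cvg_cst _).
  by rewrite subrr; exact.
have {PhiO}Phid : \forall h \near (0 : U), `|Phi (h + x, g (h + x))
    - (Phi (x, g x) + D (h, d h))| <= `|c| * e1 * Num.max `|h| `|d h|.
  have := d0 _ PhiO; rewrite nbhs_simpl /=; apply: filterS => h H.
  suff <- : (h, d h) + (x, g x) = (h + x, g (h + x)) :> U * R by exact: H.
  by congr (_, _); rewrite /d /= subrK.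
have {}Phi0 : \forall h \near (0 : U), Phi (h + x, g (h + x)) = 0.
  by move: Phi0; rewrite [in X in X -> _](near_shift 0) /= subr0.
have Phix : Phi (x, g x) = 0 by have := nbhs_singleton Phi0; rewrite add0r.
near=> h.
have Phih : Phi (h + x, g (h + x)) = 0 by near: h.
have : `|Phi (h + x, g (h + x)) - (Phi (x, g x) + D (h, d h))|
       <= `|c| * e1 * Num.max `|h| `|d h| by near: h.
rewrite Phih Phix !add0r normrN.
have -> : D (h, d h) = c * (d h - L' h).
  have -> : (h, d h) = (h, 0) + d h *: (0, 1) :> U * R.
    by congr (_, _) => /=; rewrite ?scaler0 ?addr0 ?add0r// [RHS]mulr1.
  rewrite linearD linearZ /= /L' /= /L -/c mulrBr mulNr mulrN opprK mulrA divff//.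
  by rewrite mul1r addrC [_ *: _]mulrC.
rewrite normrM -mulrA ler_pM2l ?normr_gt0// => H.
have {H} : `|d h - L' h| <= e1 * (`|h| + `|d h|).
  by apply: le_trans H _; rewrite ler_pM2l// ge_max lerDl lerDr !normr_ge0.
have -> : (g \o shift x - (cst (g x) + L')) h = d h - L' h.
  by rewrite -[LHS]/(g (h + x) - (g x + L' h)) opprD addrA.
move=> H; have dL : `|d h| <= `|d h - L' h| + `|L' h|.
  by rewrite -{1}(subrK (L' h) (d h)) ler_normD.
have e1h : e1 <= 2^-1 by rewrite ge_min lexx.
have e1e : e1 * (2 * M + 2) <= e%:num.
  by rewrite -ler_pdivlMr// ge_min lexx orbT.
have S0 : 0 <= `|h| + `|d h| by rewrite addr_ge0.
have H2 : e1 * (`|h| + `|d h|) <= 2^-1 * (`|h| + `|d h|) by rewrite ler_wpM2r.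
have := LM h => LMh.
have dh : `|h| + `|d h| <= (2 * M + 2) * `|h|.
  have := le_trans dL (lerD (le_trans H H2) LMh); nra.
apply: (le_trans H); apply: le_trans (_ : e1 * ((2 * M + 2) * `|h|) <= _).
  by rewrite ler_pM2l.
by rewrite mulrA; apply: ler_wpM2r.
Unshelve. all: by end_near. Qed.

(** The form adapted to the relaxation residual: there the unknown enters only
    through its product with the step size [h], which itself depends on the
    parameters when the step is the last one. *)
Lemma implicit_product_is_diff (W V : normedModType R) (Psi : V * R -> R)
    (p dp : W -> V) (h dh g : W -> R) x :
  is_diff x p dp -> is_diff x h dh ->
  differentiable Psi (p x, g x * h x) -> {for x, continuous g} ->
  (\forall w \near x, Psi (p w, g w * h w) = 0) ->
  h x * 'd Psi (p x, g x * h x) (0, 1) != 0 ->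
  is_diff x g (fun w => - (h x * 'd Psi (p x, g x * h x) (0, 1))^-1
                 * 'd Psi (p x, g x * h x) (dp w, g x * dh w)).
Proof.
move=> pP hP PsiD gC Psi0; set D := 'd Psi _ => c0.
pose Phi (q : W * R) := Psi (p q.1, q.2 * h q.1).
have PhiP : is_diff (x, g x) Phi
    (fun q => D (dp q.1, g x * dh q.1 + h x * q.2)).
  have f1 := is_diff_fst (x, g x); have f2 := is_diff_snd (x, g x).
  have p1 : is_diff (x, g x) (p \o fst) (dp \o fst) by exact: is_diff_comp.
  have h1 : is_diff (x, g x) (h \o fst) (dh \o fst) by exact: is_diff_comp.
  have m1 : is_diff (x, g x) (snd * (h \o fst) : W * R -> R)
      (fun q => g x * dh q.1 + h x * q.2) by apply: is_diff_eq.
  have q1 := is_diff_pairf p1 m1.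
  have PsiP : is_diff (p x, g x * h x) Psi D by exact: differentiableP.
  exact: (@is_diff_comp _ _ _ _ _ _ _ _ _ q1 PsiP).
have PhiD : differentiable Phi (x, g x) by exact: ex_diff.
have DPhi q : 'd Phi (x, g x) q = D (dp q.1, g x * dh q.1 + h x * q.2).
  by rewrite diff_val.
have dp0 : dp 0 = 0 by rewrite -(@diff_val _ _ _ _ _ _ _ pP) linear0.
have dh0 : dh 0 = 0 by rewrite -(@diff_val _ _ _ _ _ _ _ hP) linear0.
have E : 'd Phi (x, g x) (0, 1) = h x * D (0, 1).
  rewrite DPhi /= dp0 dh0 mulr0 add0r mulr1.
  have -> : (0, h x) = h x *: (0, 1) :> V * R.
    by congr (_, _); rewrite /= ?scaler0//; rewrite [RHS]mulr1.
  by rewrite linearZ.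
have := implicit_is_diff PhiD gC Psi0; rewrite E => /(_ c0) gP.
apply: is_diff_eq; apply/funext => w.
by rewrite DPhi /= mulr0 addr0.
Qed.

End implicit.

(** * Scalar products, Jacobians and block vectors *)

Section dot_theory.
Context {R : realType}.

Lemma dotE n (u v : 'cV[R]_n) : dot u v = \sum_j u j 0 * v j 0.
Proof. by rewrite /dot mxE; apply: eq_bigr => j _; rewrite mxE. Qed.

Lemma dotC n (u v : 'cV[R]_n) : dot u v = dot v u.
Proof. by rewrite !dotE; apply: eq_bigr => j _; rewrite mulrC. Qed.

Lemma dotDr n (u v w : 'cV[R]_n) : dot u (v + w) = dot u v + dot u w.
Proof. by rewrite /dot mulmxDr mxE. Qed.

Lemma dotBr n (u v w : 'cV[R]_n) : dot u (v - w) = dot u v - dot u w.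
Proof. by rewrite /dot mulmxBr mxE [(- _ : 'M__) _ _]mxE. Qed.

Lemma dotZr n c (u v : 'cV[R]_n) : dot u (c *: v) = c * dot u v.
Proof. by rewrite /dot -scalemxAr mxE. Qed.

Lemma dot0r n (u : 'cV[R]_n) : dot u 0 = 0.
Proof. by rewrite /dot mulmx0 mxE. Qed.

Lemma dot_sumr n (u : 'cV[R]_n) I (r : seq I) (Q : pred I) (f : I -> 'cV[R]_n) :
  dot u (\sum_(i <- r | Q i) f i) = \sum_(i <- r | Q i) dot u (f i).
Proof. by rewrite /dot mulmx_sumr summxE. Qed.

Lemma dot_mulmxr m n (u : 'cV[R]_m) (A : 'M[R]_(m, n)) v :
  dot u (A *m v) = dot v (A^T *m u).
Proof. by rewrite [RHS]dotC /dot trmx_mul trmxK mulmxA. Qed.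

Lemma is_diff_dot (V : normedModType R) n (u du v dv : V -> 'cV[R]_n) x :
  is_diff x u du -> is_diff x v dv ->
  is_diff x (fun z => dot (u z) (v z))
    (fun h => \sum_j (u x j 0 * dv h j 0 + v x j 0 * du h j 0)).
Proof.
move=> uP vP.
suff : is_diff x (fun z => \sum_j u z j 0 * v z j 0)
    (fun h => \sum_j (u x j 0 * dv h j 0 + v x j 0 * du h j 0)).
  by move=> sP; apply: (is_diff_ext sP) => // z; rewrite dotE.
apply: is_diff_sum => j _.
have uj : is_diff x (fun z => u z j 0) (fun h => du h j 0).
  exact: (is_diff_comp _ (is_diff_coord (u x) j 0)).
have vj : is_diff x (fun z => v z j 0) (fun h => dv h j 0).
  exact: (is_diff_comp _ (is_diff_coord (v x) j 0)).
by apply: is_diff_eq.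
Qed.

(** The transposed Jacobian is the adjoint of the differential, and vectors are
    determined by their scalar products. *)
Lemma jac_tr_mulmx m n (f : 'cV[R]_n -> 'cV[R]_m) x lam z :
  differentiable f x -> (forall v, dot lam ('d f x v) = dot v z) ->
  (jac f x)^T *m lam = z.
Proof.
move=> fD adj; apply/colP => j.
have -> : z j 0 = dot (delta_mx j 0) z.
  rewrite dotE (bigD1 j)//= mxE !eqxx mul1r big1 ?addr0// => i ij.
  by rewrite mxE (negPf ij) mul0r.
rewrite -adj dotE mxE; apply: eq_bigr => i _.
by rewrite !mxE deriveE// mulrC.
Qed.

End dot_theory.

Section block_theory.
Context {R : realType} {N s K : nat}.
Implicit Types u v : 'cV[R]_(total_dim N s K).

Lemma step_of_linear k : linear (fun v => step_of v k).
Proof. by move=> a u v; apply/colP => j; rewrite !mxE. Qed.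

Lemma stage_of_linear k i : linear (fun v => stage_of v k i).
Proof. by move=> a u v; apply/colP => j; rewrite !mxE. Qed.

Lemma stages_of_linear k : linear (fun v => stages_of v k).
Proof. by move=> a u v; apply/matrixP => j i; rewrite !mxE. Qed.

Lemma col_stages_of v k i : col i (stages_of v k) = stage_of v k i.
Proof. by apply/colP => j; rewrite !mxE. Qed.

Lemma dot_block u v : dot u v = \sum_p dot (block u p) (block v p).
Proof.
rewrite dotE [LHS](reindex _ (curry_mxvec_bij _ _)) /=.
under [RHS]eq_bigr do rewrite dotE.
by rewrite pair_bigA; apply: eq_bigr => -[p j] _; rewrite !mxE.
Qed.

(** Position 0 holds y_0; the s+1 positions after k(s+1) hold the stages
    Y_{k+1,1}, ..., Y_{k+1,s} and then y_{k+1}. *)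
Lemma dot_steps u v : dot u v = dot (step_of u 0) (step_of v 0)
  + \sum_(0 <= k < K) (\sum_i dot (stage_of u k.+1 i) (stage_of v k.+1 i)
                       + dot (step_of u k.+1) (step_of v k.+1)).
Proof.
pose F p := dot (block u (inord p)) (block v (inord p)).
rewrite dot_block (eq_bigr (fun p : 'I__ => F p)) => [|p _]; last first.
  by rewrite /F inord_val.
rewrite -(big_mkord xpredT F) big_nat_recl//; congr (_ + _).
rewrite big_nat_mul; apply: eq_bigr => k _.
rewrite -[X in \sum_(X <= _ < _) _]add0n big_addn mulSn addnK.
rewrite big_nat_recr//= big_mkord; congr (_ + _).
by apply: eq_bigr => i _; rewrite /F /stage_of /stage_pos /= addnC addnS.
Qed.

Lemma block_ext u v :
  (forall k, (k <= K)%N -> step_of u k = step_of v k) ->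
  (forall k i, (0 < k <= K)%N -> stage_of u k i = stage_of v k i) -> u = v.
Proof.
move=> stepE stageE.
suff : dot (u - v) (u - v) = 0.
  rewrite dotE => /eqP.
  rewrite psumr_eq0 => [|j _]; last by rewrite -expr2 sqr_ge0.
  move=> /allP h; apply/colP => j; apply/eqP; rewrite -subr_eq0.
  have := h j; rewrite mem_index_enum => /(_ isT) /=.
  by rewrite mulf_eq0 orbb !mxE.
have stepB k : step_of (u - v) k = step_of u k - step_of v k.
  by apply/colP => j; rewrite !mxE.
have stageB k i : stage_of (u - v) k i = stage_of u k i - stage_of v k i.
  by apply/colP => j; rewrite !mxE.
rewrite dot_steps stepB stepE// subrr dot0r add0r.
rewrite big_nat big1// => k kK; rewrite stepB stepE// subrr dot0r addr0.
by apply: big1 => i _; rewrite stageB stageE// subrr dot0r.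
Qed.

Lemma dot_assemble u (y : nat -> 'cV[R]_N) (Y : nat -> 'I_s -> 'cV[R]_N) :
  dot u (assemble y Y) = dot (step_of u 0) (y 0%N)
  + \sum_(0 <= k < K) (\sum_i dot (stage_of u k.+1 i) (Y k.+1 i)
                       + dot (step_of u k.+1) (y k.+1)).
Proof.
rewrite dot_steps step_of_assemble//; congr (_ + _).
apply: eq_big_nat => k /andP[_ kK]; rewrite step_of_assemble//; congr (_ + _).
by apply: eq_bigr => i _; rewrite stage_of_assemble.
Qed.

Lemma is_diff_assemble (V : normedModType R) (y dy : V -> nat -> 'cV[R]_N)
    (Y dY : V -> nat -> 'I_s -> 'cV[R]_N) x :
  (forall k, (k <= K)%N -> is_diff x (y^~ k) (dy^~ k)) ->
  (forall k i, (0 < k <= K)%N ->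
    is_diff x (fun t => Y t k i) (fun h => dY h k i)) ->
  is_diff x (fun t => assemble (K := K) (y t) (Y t))
    (fun h => assemble (dy h) (dY h)).
Proof.
move=> yP YP; apply: is_diff_mx => q l; rewrite (ord1 l) {l}.
case/mxvec_indexP: q => p j.
suff : is_diff x (fun t => block (assemble (K := K) (y t) (Y t)) p j 0)
    (fun h => block (assemble (K := K) (dy h) (dY h)) p j 0).
  by move/is_diff_ext; apply => t; rewrite mxE.
have pK : (p %/ s.+1 <= K)%N.
  rewrite -ltnS ltn_divLR// mulSn addSn ltnS.
  by apply: leq_trans (leq_addl _ _); rewrite -ltnS.
have pE := divn_eq p s.+1; have pm : (p %% s.+1 < s.+1)%N by rewrite ltn_mod.
case E : (p %% s.+1)%N => [|i].
  have yjP := @is_diff_comp _ _ _ _ _ _ _ _ _ (yP _ pK) (is_diff_coord _ j 0).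
  by apply: (is_diff_ext yjP) => t; rewrite block_assemble E.
have is_ : (i < s)%N by rewrite E in pm.
have pK' : (0 < (p %/ s.+1).+1 <= K)%N.
  rewrite /= -(ltn_pmul2r (ltn0Sn s)) -ltnS.
  apply: leq_trans (ltn_ord p); rewrite ltnS {2}pE E addnS ltnS.
  exact: leq_addr.
have YjP := @is_diff_comp _ _ _ _ _ _ _ _ _ (YP _ (Ordinal is_) pK')
  (is_diff_coord _ j 0).
by apply: (is_diff_ext YjP) => t; rewrite block_assemble E insubT.
Qed.

End block_theory.

(** * The relaxation parameters *)

Section step_arguments.
Context {R : realType}.

Lemma is_diff_col N s (Y : 'M[R]_(N, s)) i : is_diff Y (col i) (col i).
Proof. by apply: is_diff_linear => a u v; rewrite linearP. Qed.

Lemma is_diff_set_col N s (Y : 'M[R]_(N, s)) i x :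
  is_diff x (set_col Y i) (set_col 0 i).
Proof.
apply: is_diff_mx => j l.
have [li|li] := eqVneq l i.
  by apply: (is_diff_ext (is_diff_coord x j 0)) => v; rewrite mxE li eqxx.
by apply: (is_diff_ext (is_diff_cst (Y j l) x)) => v; rewrite !mxE (negPf li) ?mxE.
Qed.

Lemma set_col_id N s (Y : 'M[R]_(N, s)) i : set_col Y i (col i Y) = Y.
Proof. by apply/matrixP => j l; rewrite !mxE; case: eqP => // ->. Qed.

(** Used to express the differential of gamma_k through its partial
    gradients. *)
Lemma linear_step_stages N s (L : {linear ('cV[R]_N * 'M[R]_(N, s))%type -> R})
    y Y :
  L (y, Y) = dot (\col_j L (delta_mx j 0, 0)) y
    + \sum_i dot (\col_j L (0, set_col 0 i (delta_mx j 0))) (col i Y).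
Proof.
have -> : (y, Y) = \sum_j y j 0 *: (delta_mx j 0, 0)
    + \sum_i \sum_j Y j i *: (0, set_col 0 i (delta_mx j 0))
    :> 'cV[R]_N * 'M[R]_(N, s).
  have sum1 I (r : seq I) (F : I -> 'cV[R]_N * 'M[R]_(N, s)) :
      (\sum_(i <- r) F i).1 = \sum_(i <- r) (F i).1.
    by apply: (big_morph fst).
  have sum2 I (r : seq I) (F : I -> 'cV[R]_N * 'M[R]_(N, s)) :
      (\sum_(i <- r) F i).2 = \sum_(i <- r) (F i).2.
    by apply: (big_morph snd).
  apply/pair_eqP/andP; split; apply/eqP.
    rewrite /= sum1 sum1 /= [X in _ = _ + X]big1 => [|i _]; last first.
      by rewrite sum1 big1// => j _; rewrite /= scaler0.
    rewrite addr0 {1}(matrix_sum_delta y); apply: eq_bigr => j _.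
    by rewrite big_ord1.
  rewrite /= sum2 sum2 /= big1 => [|j _]; last by rewrite scaler0.
  rewrite add0r {1}(matrix_sum_delta Y) exchange_big; apply: eq_bigr => i _.
  rewrite sum2; apply: eq_bigr => j _ /=; congr (_ *: _).
  apply/matrixP => k l; rewrite !mxE; case: (l == i).
    by rewrite !andbT.
  by rewrite andbF.
rewrite linearD !linear_sum; congr (_ + _).
  by rewrite dotE; apply: eq_bigr => j _; rewrite mxE linearZ /= mulrC.
apply: eq_bigr => i _; rewrite linear_sum dotE; apply: eq_bigr => j _.
by rewrite !mxE linearZ /= mulrC.
Qed.

End step_arguments.

Section rrk_adjoint.
Context {R : realType} {N s K : nat}.
Variables (P : rrk_setup R N s) (G : relax_funs R N s).
Variables (base : 'cV[R]_(total_dim N s K)).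
Hypothesis rhs_diff : forall t y, differentiable (fun x => rhs P x t) y.
Hypothesis eta_smooth : smooth (entropy P).
Hypothesis res_nondeg : forall k, (0 < k <= K)%N ->
  derive1 (relax_res_at P G base k) (gam_at P G base k) != 0.
Hypothesis branches : implicit_branches P G base.
Local Notation vec := 'cV[R]_(total_dim N s K).
Local Notation gamma k := (gam_at P G base k).
Local Notation h k := (step_size P G base k).
Local Notation pt k := ((step_of base k.-1, stages_of base k)).
Local Notation F k i := (F_at P G base k i).
Local Notation J k i := (J_at P G base k i).

(** With step size 1, the slot for gamma holds the product of gamma and the
    actual step size, the only combination of the two that r_k depends on. *)
Definition product_res k (q : ('cV[R]_N * 'M[R]_(N, s)) * R) : R :=
  relax_res P G base k 1 q.1.1 q.1.2 q.2.

Lemma relax_resE k h y Y g :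
  relax_res P G base k h y Y g = product_res k ((y, Y), g * h).
Proof. by rewrite /product_res /relax_res /= mulr1. Qed.

Lemma is_diff_stage_rhs k i x :
  is_diff x (stage_rhs P G base k i) (mulmx (jac (stage_rhs P G base k i) x)).
Proof.
have D : differentiable (stage_rhs P G base k i) x by exact: rhs_diff.
apply: DiffDef => //; apply/funext => v; apply/colP => l.
rewrite {1}(matrix_sum_delta v) linear_sum summxE mxE; apply: eq_bigr => j _.
by rewrite big_ord1 linearZ !mxE deriveE//= mulrC.
Qed.

Lemma differentiable_product_res k q : differentiable (product_res k) q.
Proof.
have etaP x : is_diff x (entropy P) ('d (entropy P) x).
  by apply/differentiableP; have [] := eta_smooth 1.
have gradP x : {d | is_diff x (grad (entropy P)) d}.
  exists (fun h => \col_j ('d (fun x => 'D_(delta_mx j 0) (entropy P) x) x h)).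
  apply: is_diff_mx => i j.
  have D : differentiable (fun x => 'D_(delta_mx i 0) (entropy P) x) x.
    by have [_ /(_ i) []] := eta_smooth 2.
  rewrite (ord1 j).
  by apply: (is_diff_ext (differentiableP D)) => h; rewrite mxE.
have q1P := is_diff_fst q; have mP := is_diff_snd q.
have yP := @is_diff_comp _ _ _ _ _ _ _ _ _ q1P (is_diff_fst q.1).
have YP := @is_diff_comp _ _ _ _ _ _ _ _ _ q1P (is_diff_snd q.1).
have cP i := @is_diff_comp _ _ _ _ _ _ _ _ _ YP (is_diff_col q.1.2 i).
have FP i := @is_diff_comp _ _ _ _ _ _ _ _ _ (cP i)
  (is_diff_stage_rhs k i (col i q.1.2)).
have gP i := @is_diff_comp _ _ _ _ _ _ _ _ _ (cP i) (svalP (gradP (col i q.1.2))).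
have bFP i := @is_diffZ _ _ _ _ _ (rk_b P i) _ (FP i).
have SP := is_diff_sum (index_enum 'I_s) (fun i (_ : xpredT i) => bFP i).
have mSP := is_diff_scale mP SP.
have argP := is_diffD yP mSP.
have etaargP := @is_diff_comp _ _ _ _ _ _ _ _ _ argP (etaP _).
have etayP := @is_diff_comp _ _ _ _ _ _ _ _ _ yP (etaP _).
have dP i := is_diff_dot (gP i) (FP i).
have bdP i := @is_diffZ _ _ _ _ _ (rk_b P i) _ (dP i).
have dSP := is_diff_sum (index_enum 'I_s) (fun i (_ : xpredT i) => bdP i).
have mdP := is_diffM mP dSP.
have rP := is_diffB (is_diffB etaargP etayP) mdP.
apply: (@ex_diff _ _ _ _ _ _ _ (eq_ind _ (fun f => is_diff q f _) rP _ _)).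
by apply/funext => r; rewrite /product_res /relax_res /= !mulr1.
Qed.

Definition dproduct_res k := 'd (product_res k) (pt k, gamma k * h k).

Lemma is_diff_product_res_at k :
  is_diff (pt k, gamma k * h k) (product_res k) (dproduct_res k).
Proof. exact/differentiableP/differentiable_product_res. Qed.

(** Common form of the functions gamma_k with k < K and of gamma_K; the step size
    [l] matters for the latter only. *)
Definition branch k (q : 'cV[R]_N * 'M[R]_(N, s)) (l : R) : R :=
  if (k < K)%N then gam G k q.1 q.2 else gam_last G q.1 q.2 l.

Lemma gam_at_branch (v : 'cV[R]_(total_dim N s K)) k :
  gam_at P G v k
  = branch k (step_of v k.-1, stages_of v k) (step_size P G v k).
Proof. by rewrite /gam_at /gam_frozen /branch /step_size; case: ifP. Qed.

Lemma gam_frozen_branch k y Y :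
  gam_frozen P G base k y Y = branch k (y, Y) (h k).
Proof. by rewrite /gam_frozen /branch /step_size; case: ifP. Qed.

Lemma derive1_relax_res k :
  derive1 (relax_res_at P G base k) (gamma k) = h k * dproduct_res k (0, 1).
Proof.
have idP := is_diff_id (gamma k).
have mP := is_diff_scale_cst (h k) idP.
have qP := is_diff_pairf (is_diff_cst (pt k) (gamma k)) mP.
have rP := @is_diff_comp _ _ _ _ _ _ _ _ _ qP (is_diff_product_res_at k).
have -> : relax_res_at P G base k
    = product_res k \o (fun g => (pt k, g * h k)).
  by apply/funext => g; rewrite /relax_res_at relax_resE.
rewrite derive1E deriveE; last exact: (@ex_diff _ _ _ _ _ _ _ rP).
rewrite (@diff_val _ _ _ _ _ _ _ rP) /=.
have -> : (0, 1 *: h k) = h k *: (0, 1) :> ('cV[R]_N * 'M[R]_(N, s)) * R.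
  by congr (_, _) => /=; rewrite ?scaler0//; exact: mulrC.
by rewrite linearZ.
Qed.

(** The parameter [w] ranges over an arbitrary normed space so that the same
    statement gives the partial gradients of gamma_k, where only one argument
    varies, and its differential as a function of the whole vector, where the
    step size [l] may vary too. *)
Lemma branch_is_diff k (W : normedModType R) (p dp : W -> 'cV[R]_N * 'M[R]_(N, s))
    (l dl : W -> R) x :
  (0 < k <= K)%N -> is_diff x p dp -> is_diff x l dl ->
  p x = pt k -> l x = h k -> ((k < K)%N -> l = cst (dt P)) ->
  is_diff x (fun w => branch k (p w) (l w))
    (fun w => - (derive1 (relax_res_at P G base k) (gamma k))^-1
              * dproduct_res k (dp w, gamma k * dl w)).
Proof.
move=> kK pP lP px lx lcst.
have pc : {for x, continuous p} by apply/differentiable_continuous; exact: ex_diff.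
have lc : {for x, continuous l} by apply/differentiable_continuous; exact: ex_diff.
have gx : branch k (p x) (l x) = gamma k by rewrite gam_at_branch px lx.
have [gc r0] : {for x, continuous (fun w => branch k (p w) (l w))} /\
    \forall w \near x, relax_res P G base k (l w) (p w).1 (p w).2
                         (branch k (p w) (l w)) = 0.
  have [B1 B2] := branches.
  rewrite /branch; case: ltnP => [kltK|Klek].
    have /andP[k0 _] := kK.
    have [] := B1 k; first by rewrite k0.
    rewrite -/(pt k) => gc r0.
    have pc1 : p @ x --> pt k by rewrite -px; exact: pc.
    split.
      rewrite /prop_for /continuous_at px.
      exact: (@cvg_comp _ _ _ p (fun q => gam G k q.1 q.2) _ _ _ pc1 gc).
    have := pc1 _ r0.
    rewrite /= nbhs_simpl /=; apply: filterS => w /=.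
    by rewrite (lcst kltK).
  have kE : k = K by apply/eqP; rewrite eqn_leq Klek; case/andP: kK => _ ->.
  have hE : h k = dt_star P G base by rewrite /step_size ltnNge Klek.
  have plc : (fun w => (p w, l w)) @ x --> (pt k, h k).
    by apply: cvg_pair_point; [rewrite -px; exact: pc|rewrite -lx; exact: lc].
  subst k; case: B2 => gc r0; split.
    rewrite /prop_for /continuous_at px lx hE.
    rewrite hE in plc.
    exact: (@cvg_comp _ _ _ (fun w => (p w, l w))
      (fun q => gam_last G q.1.1 q.1.2 q.2) _ _ _ plc gc).
  by rewrite hE in plc; have := plc _ r0; rewrite /= nbhs_simpl.
have PsiD : differentiable (product_res k)
    (p x, branch k (p x) (l x) * l x) by exact: differentiable_product_res.
have Psi0 : \forall w \near x,
    product_res k (p w, branch k (p w) (l w) * l w) = 0.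
  by apply: filterS r0 => w; rewrite relax_resE -surjective_pairing.
have := implicit_product_is_diff pP lP PsiD gc Psi0.
rewrite gx px lx -/(dproduct_res k) -derive1_relax_res; apply.
exact: res_nondeg.
Qed.

Lemma grad_relax_param k n (p dp : 'cV[R]_n -> 'cV[R]_N * 'M[R]_(N, s)) x :
  is_diff x p dp -> p x = pt k ->
  grad (fun y => relax_res P G base k (h k) (p y).1 (p y).2 (gamma k)) x
  = \col_j dproduct_res k (dp (delta_mx j 0), 0).
Proof.
move=> pP px.
have qP := is_diff_pairf pP (is_diff_cst (gamma k * h k) x).
have dP := is_diff_product_res_at k; rewrite -px in dP.
have rP := @is_diff_comp _ _ _ _ _ _ _ _ _ qP dP.
apply/colP => j; rewrite !mxE.
rewrite (_ : (fun y => _) = product_res k \o (fun y => (p y, gamma k * h k))).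
  rewrite deriveE; last exact: (@ex_diff _ _ _ _ _ _ _ rP).
  by rewrite (@diff_val _ _ _ _ _ _ _ rP).
by apply/funext => y; rewrite relax_resE -surjective_pairing.
Qed.

Lemma grad_branch_param k n (p dp : 'cV[R]_n -> 'cV[R]_N * 'M[R]_(N, s)) x :
  (0 < k <= K)%N -> is_diff x p dp -> p x = pt k ->
  grad (fun y => branch k (p y) (h k)) x
  = - (derive1 (relax_res_at P G base k) (gamma k))^-1
    *: grad (fun y => relax_res P G base k (h k) (p y).1 (p y).2 (gamma k)) x.
Proof.
move=> kK pP px; rewrite (grad_relax_param pP px).
have hcst : (k < K)%N -> cst (h k) = cst (dt P) :> ('cV[R]_n -> R).
  by move=> kltK; rewrite /step_size kltK.
have gP := branch_is_diff kK pP (is_diff_cst (h k) x) px erefl hcst.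
apply/colP => j; rewrite !mxE deriveE; last exact: (@ex_diff _ _ _ _ _ _ _ gP).
by rewrite (@diff_val _ _ _ _ _ _ _ gP) /= mulr0.
Qed.

(** The differential of gamma_k at fixed step size. *)
Definition dgam k (q : 'cV[R]_N * 'M[R]_(N, s)) : R :=
  dot (grad_y_gam P G base k) q.1
  + \sum_i dot (grad_Y_gam P G base k i) (col i q.2).

Lemma is_diff_step_arg k x :
  is_diff x (fun y : 'cV[R]_N => (y, stages_of base k)) (fun y => (y, 0)).
Proof. exact: is_diff_pairf (is_diff_id x) (is_diff_cst _ _). Qed.

Lemma is_diff_stage_arg k i x :
  is_diff x (fun z : 'cV[R]_N => (step_of base k.-1, set_col (stages_of base k) i z))
  (fun z => (0, set_col 0 i z)).
Proof. exact: is_diff_pairf (is_diff_cst _ _) (is_diff_set_col _ _ _). Qed.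

Lemma stage_arg_at k i :
  (step_of base k.-1, set_col (stages_of base k) i (stage_of base k i)) = pt k.
Proof. by rewrite -col_stages_of set_col_id. Qed.

Lemma grad_y_gamE k : (0 < k <= K)%N ->
  grad_y_gam P G base k
  = - (derive1 (relax_res_at P G base k) (gamma k))^-1 *: grad_y_res P G base k.
Proof.
move=> kK; rewrite -(grad_branch_param kK (is_diff_step_arg k _) erefl).
suff -> : (fun y => branch k (y, stages_of base k) (h k))
    = fun y => gam_frozen P G base k y (stages_of base k) by [].
by apply/funext => y; rewrite gam_frozen_branch.
Qed.

Lemma grad_Y_gamE k i : (0 < k <= K)%N ->
  grad_Y_gam P G base k i
  = - (derive1 (relax_res_at P G base k) (gamma k))^-1 *: grad_Y_res P G base k i.
Proof.
move=> kK.
rewrite -(grad_branch_param kK (is_diff_stage_arg k i _) (stage_arg_at k i)).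
suff -> : (fun z => branch k (step_of base k.-1, set_col (stages_of base k) i z) (h k))
    = fun z => gam_frozen P G base k (step_of base k.-1)
                 (set_col (stages_of base k) i z) by [].
by apply/funext => z; rewrite gam_frozen_branch.
Qed.

Lemma step_size_neq0 k : (0 < k <= K)%N -> h k != 0.
Proof.
by move=> /res_nondeg; rewrite derive1_relax_res mulf_eq0 negb_or => /andP[].
Qed.

Lemma dgamE k q : (0 < k <= K)%N ->
  dgam k q = - (derive1 (relax_res_at P G base k) (gamma k))^-1
             * dproduct_res k (q, 0).
Proof.
move=> kK; rewrite /dgam grad_y_gamE//.
under eq_bigr do rewrite grad_Y_gamE// dotC dotZr.
rewrite dotC dotZr -mulr_sumr -mulrDr; congr (_ * _).
have -> : grad_y_res P G base k = \col_j dproduct_res k ((delta_mx j 0, 0), 0).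
  exact: (grad_relax_param (is_diff_step_arg k _) erefl).
have YE i : grad_Y_res P G base k i
    = \col_j dproduct_res k ((0, set_col 0 i (delta_mx j 0)), 0).
  exact: (grad_relax_param (is_diff_stage_arg k i _) (stage_arg_at k i)).
under eq_bigr do rewrite YE.
have lin : linear (fun r : 'cV[R]_N * 'M[R]_(N, s) => dproduct_res k (r, 0)).
  move=> a u v.
  have -> : (a *: u + v, 0) = a *: (u, 0) + (v, 0)
      :> ('cV[R]_N * 'M[R]_(N, s)) * R.
    by congr (_, _); rewrite /= scaler0 addr0.
  by rewrite [LHS]linearP.
pose linM := GRing.isLinear.Build _ _ _ _ _ lin.
pose L : {linear ('cV[R]_N * 'M[R]_(N, s))%type -> R} :=
  HB.pack (fun r : 'cV[R]_N * 'M[R]_(N, s) => dproduct_res k (r, 0)) linM.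
rewrite [q]surjective_pairing -[RHS]/(L (q.1, q.2)) linear_step_stages.
by rewrite dotC; congr (_ + _); apply: eq_bigr => i _; rewrite dotC.
Qed.

(** The term in [dl] is the derivative of gamma_k with respect to the step size
    that keeps the product gamma_k h_k fixed to first order. *)
Lemma branch_is_diffE k (W : normedModType R) (p dp : W -> 'cV[R]_N * 'M[R]_(N, s))
    (l dl : W -> R) x :
  (0 < k <= K)%N -> is_diff x p dp -> is_diff x l dl ->
  p x = pt k -> l x = h k -> ((k < K)%N -> l = cst (dt P)) ->
  is_diff x (fun w => branch k (p w) (l w))
    (fun w => dgam k (dp w) - gamma k / h k * dl w).
Proof.
move=> kK pP lP px lx lcst.
apply: (is_diff_ext (branch_is_diff kK pP lP px lx lcst)) => // w.
rewrite dgamE//; have h0 := step_size_neq0 kK.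
have := res_nondeg kK; rewrite derive1_relax_res.
set D := dproduct_res k => c0.
have -> : (dp w, gamma k * dl w) = (dp w, 0) + (gamma k * dl w) *: (0, 1)
    :> ('cV[R]_N * 'M[R]_(N, s)) * R.
  by congr (_, _) => /=; rewrite ?scaler0 ?addr0// add0r [RHS]mulr1.
rewrite linearD linearZ /= -/D -[_ *: D _]/(_ * _).
by field; rewrite h0; move: c0; rewrite mulf_eq0 negb_or => /andP[].
Qed.

Definition dgam_at k (v : vec) : R := dgam k (step_of v k.-1, stages_of v k).

Definition dstep_size k (v : vec) : R :=
  if (k < K)%N then 0 else - (dt P * \sum_(1 <= l < K) dgam_at l v).

Lemma is_diff_gam_at k dl : (0 < k <= K)%N ->
  is_diff base (fun v => step_size P G v k) dl ->
  is_diff base (fun v => gam_at P G v k)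
    (fun v => dgam_at k v - gamma k / h k * dl v).
Proof.
move=> kK lP.
have pP : is_diff base (fun v : vec => (step_of v k.-1, stages_of v k))
    (fun v => (step_of v k.-1, stages_of v k)).
  apply: is_diff_pairf.
    by apply: is_diff_linear; exact: step_of_linear.
  by apply: is_diff_linear; exact: stages_of_linear.
have lcst : (k < K)%N -> (fun v : vec => step_size P G v k) = cst (dt P).
  by move=> kltK; apply/funext => v; rewrite /step_size kltK.
apply: (is_diff_ext (branch_is_diffE kK pP lP erefl erefl lcst)) => v //.
by rewrite gam_at_branch.
Qed.

Lemma is_diff_step_size k : (0 < k <= K)%N ->
  is_diff base (fun v => step_size P G v k) (dstep_size k).
Proof.
case/andP => k0 kK; rewrite /step_size /dstep_size; case: (ltnP k K) => [_|Klek].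
  exact: is_diff_cst.
have gP l : (1 <= l < K)%N -> is_diff base
    (fun v => gam G l (step_of v l.-1) (stages_of v l)) (dgam_at l).
  move=> /andP[l0 lK]; have lK' : (0 < l <= K)%N by rewrite l0 ltnW.
  have lP : is_diff base (fun v => step_size P G v l) (cst 0).
    apply: (is_diff_ext (is_diff_cst (dt P) base)) => v; first by rewrite /step_size lK.
    by [].
  apply: (is_diff_ext (is_diff_gam_at lK' lP)) => v.
    by rewrite /gam_at /gam_frozen lK.
  by rewrite mulr0 subr0.
have SP := is_diff_sum (index_iota 1 K) gP.
have dP := is_diffB (is_diff_cst (tend P) base) (is_diffZ (dt P) SP).
apply: (is_diff_ext dP) => v.
  rewrite /dt_star /step_time prednK; last exact: leq_trans k0 kK.
  by rewrite [in RHS]big_nat.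
rewrite [in RHS]big_nat.
rewrite -[LHS]/(0 - dt P * \sum_(1 <= i < K | (0 < i < K)%N) dgam_at i v).
by rewrite sub0r.
Qed.

(** The contribution - (gamma_k / h_k) dh of the step size to the variation of
    gamma_k cancels against gamma_k dh. *)
Lemma is_diff_increment k : (0 < k <= K)%N ->
  is_diff base (fun v => gam_at P G v k * step_size P G v k)
    (fun v => h k * dgam_at k v).
Proof.
move=> kK; have hP := is_diff_step_size kK.
have gP := is_diff_gam_at kK hP.
apply: (is_diff_ext (is_diffM gP hP)) => // v.
rewrite -[LHS]/(gamma k * dstep_size k v
  + h k * (dgam_at k v - gamma k / h k * dstep_size k v)).
by field; exact: step_size_neq0.
Qed.

(** * Linearization of the reduced operator *)

Definition dreduced_step k (v : vec) : 'cV[R]_N :=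
  if k == 0%N then step_of v 0 else
    step_of v k - step_of v k.-1
    - ((h k * dgam_at k v) *: \sum_i rk_b P i *: F k i
       + (gamma k * h k) *: \sum_i rk_b P i *: (J k i *m stage_of v k i)).

Definition dreduced_stage k i (v : vec) : 'cV[R]_N :=
  stage_of v k i - step_of v k.-1
  - (dstep_size k v *: \sum_j rk_a P i j *: F k j
     + h k *: \sum_j rk_a P i j *: (J k j *m stage_of v k j)).

Lemma is_diff_reduced_op : is_diff base (reduced_op P G base)
  (fun v => assemble (dreduced_step ^~ v) (fun k i => dreduced_stage k i v)).
Proof.
have stepP k : is_diff base (fun v : vec => step_of v k) (fun v => step_of v k).
  by apply: is_diff_linear; exact: step_of_linear.
have stageP k i : is_diff base (fun v : vec => stage_of v k i) (fun v => stage_of v k i).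
  by apply: is_diff_linear; exact: stage_of_linear.
have FP k i := @is_diff_comp _ _ _ _ _ _ _ _ _ (stageP k i)
  (is_diff_stage_rhs k i (stage_of base k i)).
apply: is_diff_assemble => [k kK|k i kK].
  case: k kK => [|k] kK.
    apply: (is_diff_ext (is_diffB (stepP 0%N) (is_diff_cst (yinit P) base))) => v //.
    by rewrite -[LHS]/(step_of v 0 - 0) subr0.
  have SP := is_diff_sum (index_enum 'I_s)
    (fun i (_ : xpredT i) => is_diffZ (rk_b P i) (FP k.+1 i)).
  have mP := is_diff_scale (is_diff_increment (k := k.+1) kK) SP.
  exact: (is_diff_ext (is_diffB (is_diffB (stepP k.+1) (stepP k)) mP)).
have SP := is_diff_sum (index_enum 'I_s)
  (fun j (_ : xpredT j) => is_diffZ (rk_a P i j) (FP k j)).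
have mP := is_diff_scale (is_diff_step_size kK) SP.
exact: (is_diff_ext (is_diffB (is_diffB (stageP k i) (stepP k.-1)) mP)).
Qed.

(** * The adjoint equations *)

(** The factor of the variation of gamma_k in the adjoint equations: the last
    step size does not depend on gamma_K, so xi_star enters for k < K only. *)
Definition xi_net (lam : vec) k : R :=
  xi P G base lam k - (if (k < K)%N then xi_star P G base lam else 0).

Definition adj_stage_incr (lam : vec) k i : 'cV[R]_N :=
  h k *: ((J k i)^T *m ((gamma k * rk_b P i) *: step_of lam k
                        + \sum_j rk_a P j i *: stage_of lam k j))
  + xi_net lam k *: grad_Y_gam P G base k i.

Definition adj_stage (lam : vec) k i : 'cV[R]_N :=
  stage_of lam k i - adj_stage_incr lam k i.

Definition adj_step_incr (lam : vec) k : 'cV[R]_N :=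
  step_of lam k + \sum_i stage_of lam k i + xi_net lam k *: grad_y_gam P G base k.

Definition adj_step (lam : vec) k : 'cV[R]_N :=
  step_of lam k - (if (k < K)%N then adj_step_incr lam k.+1 else 0).

(** The last two terms are the defect between step k of the linearized method
    paired with [lam] and the adjoint step k paired with [v]. *)
Lemma dot_dreduced_pair (lam v : vec) k : (0 < k)%N ->
  \sum_i dot (stage_of lam k i) (dreduced_stage k i v)
    + dot (step_of lam k) (dreduced_step k v)
  = \sum_i dot (stage_of v k i) (adj_stage lam k i)
    + dot (step_of v k) (step_of lam k) - dot (step_of v k.-1) (adj_step_incr lam k)
    - dstep_size k v
      * (\sum_i \sum_j rk_a P j i * dot (F k i) (stage_of lam k j))
    - (xi P G base lam k - xi_net lam k) * dgam_at k v.
Proof.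
move=> k0.
have -> : \sum_i dot (stage_of lam k i) (dreduced_stage k i v)
    = \sum_i dot (stage_of lam k i) (stage_of v k i)
      - \sum_i dot (stage_of lam k i) (step_of v k.-1)
      - (dstep_size k v
           * (\sum_i \sum_j rk_a P j i * dot (F k i) (stage_of lam k j))
         + h k * \sum_i \sum_j
             rk_a P i j * dot (stage_of lam k i) (J k j *m stage_of v k j)).
  rewrite exchange_big !mulr_sumr -big_split -sumrB -sumrB /=.
  apply: eq_bigr => i _; rewrite !dotBr dotDr !dotZr !dot_sumr.
  by congr (_ - (_ * _ + _ * _)); apply: eq_bigr => j _;
    rewrite dotZr// dotC.
have -> : dot (step_of lam k) (dreduced_step k v)
    = dot (step_of lam k) (step_of v k) - dot (step_of lam k) (step_of v k.-1)
      - (xi P G base lam k * dgam_at k v + gamma k * h k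
           * \sum_i rk_b P i * dot (step_of lam k) (J k i *m stage_of v k i)).
  rewrite /dreduced_step -[k == 0]negbK -lt0n k0 /= !dotBr dotDr !dotZr !dot_sumr.
  congr (_ - (_ + _)).
    rewrite /xi mulrAC; congr (_ * _ * _); apply: eq_bigr => i _.
    by rewrite dotZr dotC.
  by congr (_ * _); apply: eq_bigr => i _; rewrite dotZr.
have -> : \sum_i dot (stage_of v k i) (adj_stage lam k i)
    = \sum_i dot (stage_of lam k i) (stage_of v k i)
      - (h k * (gamma k
           * (\sum_i rk_b P i * dot (step_of lam k) (J k i *m stage_of v k i))
           + \sum_i \sum_j
             rk_a P i j * dot (stage_of lam k i) (J k j *m stage_of v k j))
         + xi_net lam k * \sum_i dot (grad_Y_gam P G base k i) (stage_of v k i)).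
  rewrite [X in gamma k * _ + X]exchange_big !mulr_sumr -big_split /= !mulr_sumr.
  rewrite -big_split -sumrB /=.
  apply: eq_bigr => i _.
  rewrite /adj_stage /adj_stage_incr dotBr dotDr !dotZr -dot_mulmxr.
  rewrite dotC; congr (_ - (_ * _ + _ * _)); last exact: dotC.
  rewrite dotC dotDr dotZr dot_sumr -mulrA dotC; congr (_ + _).
  by apply: eq_bigr => j _; rewrite dotZr dotC.
have -> : dgam_at k v = dot (grad_y_gam P G base k) (step_of v k.-1)
    + \sum_i dot (grad_Y_gam P G base k i) (stage_of v k i).
  by congr (_ + _); apply: eq_bigr => i _; rewrite col_stages_of.
rewrite /adj_step_incr !dotDr dotZr dot_sumr.
have -> : \sum_i dot (step_of v k.-1) (stage_of lam k i)
    = \sum_i dot (stage_of lam k i) (step_of v k.-1).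
  by apply: eq_bigr => i _; rewrite dotC.
rewrite (dotC (step_of v k)) (dotC (step_of v k.-1)) (dotC (step_of v k.-1)).
ring.
Qed.

(** Summation by parts: y_{k-1} occurs in the equations of step k, which moves
    the adjoint increment of step k to the block of y_{k-1}.  The defects of the
    steps k < K cancel against that of step K. *)
Lemma jac_reduced_op_tr (lam : vec) : (0 < K)%N ->
  (jac (reduced_op P G base) base)^T *m lam
  = assemble (adj_step lam) (adj_stage lam).
Proof.
move=> K0; apply: jac_tr_mulmx.
  exact: (@ex_diff _ _ _ _ _ _ _ is_diff_reduced_op).
move=> v; rewrite (@diff_val _ _ _ _ _ _ _ is_diff_reduced_op).
rewrite !dot_assemble.
pose S k := \sum_i \sum_j rk_a P j i * dot (F k i) (stage_of lam k j).
pose defect k := dstep_size k v * S k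
  + (xi P G base lam k - xi_net lam k) * dgam_at k v.
pose D k := dot (step_of v k) (if (k < K)%N then adj_step_incr lam k.+1 else 0).
(* The variation of the last step size, - dt times the sum of the variations of
   gamma_l, turns the stage terms of step K into - xi_star times that sum. *)
have defect0 : \sum_(0 <= k < K) defect k.+1 = 0.
  rewrite -{1}(prednK K0) big_nat_recr//= prednK//.
  rewrite /defect {2}/dstep_size {2}/xi_net ltnn subr0 subrr mul0r addr0.
  rewrite big_add1 /= mulNr mulrAC -/(xi_star P G base lam).
  apply/eqP; rewrite subr_eq0; apply/eqP; rewrite mulr_sumr.
  apply: eq_big_nat => k /andP[_ kK1].
  have kK : (k.+1 < K)%N by rewrite -ltn_predRL.
  by rewrite /dstep_size /xi_net kK mul0r add0r opprB addrC subrK.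
have shift : \sum_(0 <= k < K) D k = D 0%N + \sum_(0 <= k < K) D k.+1.
  rewrite -(big_nat_recl _ _ D)// big_nat_recr//= {3}/D ltnn dot0r addr0.
  by [].
transitivity (dot (step_of v 0) (step_of lam 0)
    + \sum_(0 <= k < K)
        (\sum_i dot (stage_of v k.+1 i) (adj_stage lam k.+1 i)
         + dot (step_of v k.+1) (step_of lam k.+1))
    - \sum_(0 <= k < K) D k).
  rewrite -addrA dotC; congr (_ + _).
  rewrite -[RHS]subr0 -[X in _ = _ - X]defect0 -!sumrB.
  apply: eq_big_nat => k /andP[_ kK].
  by rewrite dot_dreduced_pair// /defect /D /S kK; ring.
rewrite shift /adj_step dotBr -/(D 0%N) opprD addrACA; congr (_ + _).
by rewrite -sumrB; apply: eq_bigr => k _; rewrite dotBr addrA.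
Qed.

Lemma subr_eqP (V : zmodType) (x a w : V) : x - a = w <-> x = a + w.
Proof. by split=> [<-|->]; rewrite addrC ?subrK ?addKr. Qed.

Lemma adjoint_time_stepping (w lam : vec) : (0 < K)%N ->
  (jac (reduced_op P G base) base)^T *m lam = w <->
  step_of lam K = step_of w K /\
  forall k, (0 < k <= K)%N ->
    step_of lam k.-1 = adj_step_incr lam k + step_of w k.-1 /\
    forall i, stage_of lam k i = adj_stage_incr lam k i + stage_of w k i.
Proof.
move=> K0; rewrite jac_reduced_op_tr//; split.
  move=> <-; split; first by rewrite step_of_assemble// /adj_step ltnn subr0.
  move=> k kK; have /andP[k0 k_leK] := kK.
  have kK1 : (k.-1 < K)%N by rewrite prednK.
  split=> [|i]; apply/subr_eqP.
    by rewrite step_of_assemble 1?ltnW// /adj_step kK1 prednK.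
  by rewrite stage_of_assemble.
move=> [lamK steps]; apply: block_ext => [k kK|k i kK].
  rewrite step_of_assemble// /adj_step; case: ltnP => [kltK|Klek].
    by apply/subr_eqP; have [] := steps k.+1 kltK.
  have -> : k = K by apply/eqP; rewrite eqn_leq kK.
  by rewrite subr0.
rewrite stage_of_assemble//; apply/subr_eqP.
by have [_] := steps k kK; exact.
Qed.

End rrk_adjoint.

Theorem lemma4 (R : realType) (N s K : nat) (K_gt0 : (0 < K)%N)
    (P : rrk_setup R N s) (G : relax_funs R N s)
    (ybar : 'cV[R]_(total_dim N s K))
    (rhs_diff : forall t y, differentiable (fun x => rhs P x t) y)
    (eta_smooth : smooth (entropy P))
    (eta_convex : convex_function (E := 'cV[R]_N) setT (entropy P))
    (T_gt0 : 0 < tend P) (dt_gt0 : 0 < dt P) (dt_star_gt0 : 0 < dt_star P G ybar)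
    (ybar_sol : rrk_solution P G ybar)
    (res_nondeg : forall k, (0 < k <= K)%N ->
       derive1 (relax_res_at P G ybar k) (gam_at P G ybar k) != 0)
    (branches : implicit_branches P G ybar) :
  [/\ differentiable (reduced_op P G ybar) ybar,
      forall k, (0 < k <= K)%N ->
        let drdg := derive1 (relax_res_at P G ybar k) (gam_at P G ybar k) in
        grad_y_gam P G ybar k = - drdg^-1 *: grad_y_res P G ybar k /\
        forall i, grad_Y_gam P G ybar k i = - drdg^-1 *: grad_Y_res P G ybar k i
    & forall w lam : 'cV[R]_(total_dim N s K),
      (jac (reduced_op P G ybar) ybar)^T *m lam = w <->
      [/\ step_of lam K = step_of w K,
          step_of lam K.-1 =
            step_of lam K + \sum_i stage_of lam K i
            + xi P G ybar lam K *: grad_y_gam P G ybar K + step_of w K.-1,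
          forall i, stage_of lam K i =
            dt_star P G ybar *: ((J_at P G ybar K i)^T *m
              ((gam_at P G ybar K * rk_b P i) *: step_of lam K
               + \sum_j rk_a P j i *: stage_of lam K j))
            + xi P G ybar lam K *: grad_Y_gam P G ybar K i + stage_of w K i
        & forall k, (0 < k < K)%N ->
          step_of lam k.-1 =
            step_of lam k + \sum_i stage_of lam k i
            + (xi P G ybar lam k - xi_star P G ybar lam) *: grad_y_gam P G ybar k
            + step_of w k.-1 /\
          forall i, stage_of lam k i =
            dt P *: ((J_at P G ybar k i)^T *m
              ((gam_at P G ybar k * rk_b P i) *: step_of lam k
               + \sum_j rk_a P j i *: stage_of lam k j))
            + (xi P G ybar lam k - xi_star P G ybar lam) *: grad_Y_gam P G ybar k i
            + stage_of w k i]].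
Proof.
split=> [||w lam].
- exact: (@ex_diff _ _ _ _ _ _ _
    (is_diff_reduced_op rhs_diff eta_smooth res_nondeg branches)).
- by move=> k kK /=; split=> [|i]; [exact: grad_y_gamE|exact: grad_Y_gamE].
have KK : (0 < K <= K)%N by rewrite K_gt0 leqnn.
have netK : xi_net P G ybar lam K = xi P G ybar lam K.
  by rewrite /xi_net ltnn subr0.
have hK : step_size P G ybar K = dt_star P G ybar by rewrite /step_size ltnn.
have netk k : (k < K)%N ->
    xi_net P G ybar lam k = xi P G ybar lam k - xi_star P G ybar lam.
  by move=> kK; rewrite /xi_net kK.
have hk k : (k < K)%N -> step_size P G ybar k = dt P.
  by move=> kK; rewrite /step_size kK.
rewrite (adjoint_time_stepping rhs_diff eta_smooth res_nondeg branches w lam K_gt0).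
split=> [[lamK steps]|[lamK stepK stageK steps]].
  have [stepK stageK] := steps K KK; split=> //.
  - by rewrite stepK /adj_step_incr netK.
  - by move=> i; rewrite stageK /adj_stage_incr netK hK.
  move=> k /andP[k0 kK]; have [|stepk stagek] := steps k; first by rewrite k0 ltnW.
  split=> [|i]; first by rewrite stepk /adj_step_incr netk.
  by rewrite stagek /adj_stage_incr netk// hk.
split=> // k /andP[k0]; rewrite leq_eqVlt => /orP[/eqP ->|kK].
  split=> [|i]; first by rewrite /adj_step_incr netK.
  by rewrite /adj_stage_incr netK hK.
have [|stepk stagek] := steps k; first by rewrite k0.
split=> [|i]; first by rewrite /adj_step_incr netk.
by rewrite /adj_stage_incr netk// hk.
Qed.
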